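(* For MLAPD on any rooted tree of depth $D$, the online algorithm \textsc{Waterfall} is $D$-competitive: on every instance, the total cost of its schedule is at most $D$ times the cost of an optimal schedule.
   Context: MLAPD: an instance is a rooted tree $\mathcal{T}$ with root $r$ and positive node costs $c(v)>0$, together with a set of requests $\rho=(v,a,d)$ issued at node $v$ with arrival time $a$ and deadline $d\ge a$ (deadlines distinct). A service $(S,t)$ is a subtree $S\ni r$ of $\mathcal{T}$ transmitted at time $t$, costing $c(S)=\sum_{u\in S}c(u)$; it satisfies $(v,a,d)$ if $v\in S$ and $a\le t\le d$. A feasible schedule satisfies every request; its cost is the sum of its service costs. Online: requests are revealed at arrival; the tree is known. Depth $D$: maximum number of nodes on a root-to-leaf path. $c$-competitive: cost at most $c$ times optimal on every instance. $\mathcal{T}_v$ is the subtree rooted at $v$. A request is pending at time $t$ if it has arrived by $t$ and was not satisfied by earlier transmissions. For a pending request $\rho$ in $\mathcal{T}_v$, $P(v\to\rho)$ is the node set of the path from $v$ to the node of $\rho$, $P_\rho=P(r\to\rho)$, and for a node set $S$, $P(v\to\rho\mid S)=P(v\to\rho)\setminus S$. \textsc{Waterfall}: every node $u$ carries a price $p(u)$, initialized to $c(u)$; write $p(X)=\sum_{u\in X}p(u)$. When a pending request $\rho$ reaches its deadline $t=d_\rho$: set $S=P_\rho$ and $p(v)=c(v)$ for $v\in P_\rho$; put the nodes of $P_\rho$ into a FIFO queue $Q$; while $Q\ne\emptyset$, dequeue a node $v$, run the $v$-fall on $S$ and enqueue every node it returns; finally transmit $(S,t)$. The $v$-fall: set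 $A=\emptyset$ and budget $b=c(v)$; go through the pending requests $\gamma$ in $\mathcal{T}_v$ in increasing order of deadline; for each, let $P=P(v\to\gamma\mid S)$ with the current $S$; if $p(P)>b$, replace $p(u)$ by $p(u)(1-b/p(P))$ for every $u\in P$ and stop; otherwise add $P$ to $A$ and to $S$, set $b\gets b-p(P)$, and reset $p(u)=c(u)$ for all $u\in P$. The $v$-fall returns $A$. *)

(* Defs.v *)
From HB Require Import structures.
From mathcomp Require Import all_boot all_order all_algebra.
Set Implicit Arguments. Unset Strict Implicit. Unset Printing Implicit Defensive.
Import Order.TTheory GRing.Theory Num.Theory.
Local Open Scope ring_scope.

Section MLAPD.
Variable R : realFieldType.
Variable V : finType.
Variable r : V.
Variable par : V -> V.

(* A rooted tree: the root is its own parent and every node reaches the root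
   by iterating the parent map (this rules out cycles). *)
Definition is_rooted_tree : Prop :=
  par r = r /\ forall v : V, exists n : nat, iter n par v = r.

Definition anc (u v : V) : bool := [exists n : 'I_#|V|, iter n par v == u].

(* node set of the path from u down to w (empty if w not in T_u) *)
Definition path_set (u w : V) : {set V} := [set x | anc u x && anc x w].
Definition root_path (v : V) : {set V} := [set x | anc x v].

Definition leaf (v : V) : bool := [forall w, (par w == v) ==> (w == v)].
Definition depth : nat := \max_(v | leaf v) #|root_path v|.

Definition request := (V * R * R)%type.
Definition rnode (q : request) : V := q.1.1.
Definition rarr (q : request) : R := q.1.2.
Definition rdead (q : request) : R := q.2.

(* Services: (subtree, time) *)
Definition service := ({set V} * R)%type.
Definition is_subtree (S : {set V}) : bool :=
  (r \in S) && [forall u in S, par u \in S].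
Definition satisfies (s : service) (q : request) : bool :=
  (rnode q \in s.1) && (rarr q <= s.2 <= rdead q).

Variable c : V -> R.

Definition set_cost (f : V -> R) (S : {set V}) : R := \sum_(u in S) f u.
Definition sched_cost (sched : seq service) : R :=
  \sum_(s <- sched) set_cost c s.1.

Definition feasible (reqs : seq request) (sched : seq service) : Prop :=
  (forall s, s \in sched -> is_subtree s.1) /\
  (forall q, q \in reqs -> has (fun s => satisfies s q) sched).

(* pending at time t w.r.t. the transmissions made so far (all earlier) *)
Definition pending (trans : seq service) (t : R) (q : request) : bool :=
  (rarr q <= t) && ~~ has (fun s => satisfies s q) trans.

Fixpoint vfall_loop (v : V) (l : seq request) (S : {set V}) (p : V -> R)
    (b : R) (A : {set V}) : {set V} * (V -> R) * {set V} :=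
  match l with
  | [::] => (S, p, A)
  | g :: l' =>
      let P := path_set v (rnode g) :\: S in
      let pP := set_cost p P in
      if b < pP then
        (S, (fun u => if u \in P then p u * (1 - b / pP) else p u), A)
      else
        vfall_loop v l' (S :|: P) (fun u => if u \in P then c u else p u)
          (b - pP) (A :|: P)
  end.

(* the v-fall on S; pend = pending requests sorted by increasing deadline.
   Returns (new S, new prices, A). *)
Definition vfall (pend : seq request) (v : V) (S : {set V}) (p : V -> R) :=
  vfall_loop v [seq g <- pend | anc v (rnode g)] S p (c v) set0.

Variable enq : {set V} -> seq V.  (* order in which a returned set is enqueued *)

(* FIFO queue processing; each node is enqueued at most once, so #|V|
   dequeue steps suffice. *)
Fixpoint queue_loop (pend : seq request) (n : nat) (Q : seq V) (S : {set V})
    (p : V -> R) : {set V} * (V -> R) :=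
  match n with
  | 0 => (S, p)
  | n'.+1 =>
      match Q with
      | [::] => (S, p)
      | v :: Q' =>
          let '(S1, p1, A1) := vfall pend v S p in
          queue_loop pend n' (Q' ++ enq A1) S1 p1
      end
  end.

Definition wf_step (sorted_reqs : seq request)
    (st : seq service * (V -> R)) (rho : request) : seq service * (V -> R) :=
  let '(trans, p) := st in
  let t := rdead rho in
  if pending trans t rho then
    let pend := [seq g <- sorted_reqs | pending trans t g] in
    let P := root_path (rnode rho) in
    let p0 := fun u => if u \in P then c u else p u in
    let '(S1, p1) := queue_loop pend #|V| (enq P) P p0 in
    (rcons trans (S1, t), p1)
  else (trans, p).

Definition waterfall (reqs : seq request) : seq service :=
  let sreqs := sort (fun x y : request => rdead x <= rdead y) reqs in
  (foldl (wf_step sreqs) ([::], c) sreqs).1.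

End MLAPD.

(* Main.v *)
Require Import Defs.
From HB Require Import structures.
From mathcomp Require Import all_boot all_order all_algebra.
From mathcomp Require Import zify ring lra.
Import Order.TTheory GRing.Theory Num.Theory.
Set Implicit Arguments.
Unset Strict Implicit.
Unset Printing Implicit Defensive.
Local Open Scope ring_scope.

(** Call a pair (j, v) an item if v belongs to the j-th Waterfall service; the
item lasts until the next service of v. In each service the v-fall invests at
most c(v) in strict descendants of v, the share of w going to the item of w that
is current at that moment. An item of w receives at most c(w), and exactly c(w)
if it ends with a service for which w is not on the path of the triggering
request. An item of v is good if the reference schedule serves v while the item
lasts. It is down if it is not good, its fall exhausted the budget, and the
reference schedule does not serve v between the fall and the deadline at which
the fall stopped. It is up if it has an end and is neither good nor down.

A request that is pending at a service was either absent from the previous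
service of a node above it, or made the fall of that node stop. Hence down items
invest only in good or down items, up items receive only from good or up items,
and an item that ends on the path of a triggering request is good or down. So
down items send out all of their cost and up items are paid in full.
Let l(v) be the number of edges between v and the root. As l increases along
investments, weighting costs by l shows that the down items cost in total at
most the sum of l(v) c(v) over the good items; dually, the up items cost at most
the sum of (D - 1 - l(v)) c(v). The total cost is thus at most D times the cost
of the good items, and distinct good items of v are charged to distinct services
of v in the reference schedule. *)

Section NonnegativeSums.
Variables (R : numDomainType) (I : finType) (F : I -> R).
Hypothesis F_ge0 : forall i, 0 <= F i.

Lemma ler_sum_subpred (P Q : pred I) :
  (forall i, P i -> Q i) -> \sum_(i | P i) F i <= \sum_(i | Q i) F i.
Proof.
move=> PQ; rewrite [leLHS]big_mkcond [leRHS]big_mkcond /=.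
by apply: ler_sum => i _; case: ifPn => [/PQ ->|_] //; case: ifP.
Qed.

Lemma ler_sum_predU (P Q : pred I) :
  \sum_(i | P i || Q i) F i <= \sum_(i | P i) F i + \sum_(i | Q i) F i.
Proof.
rewrite big_mkcond [X in X + _]big_mkcond [X in _ + X]big_mkcond -big_split /=.
apply: ler_sum => i _.
by case: (P i); case: (Q i); rewrite ?addr0 ?add0r // lerDl.
Qed.

Lemma ler_sum_setU (A B : {set I}) :
  \sum_(i in A :|: B) F i <= \sum_(i in A) F i + \sum_(i in B) F i.
Proof. by under eq_bigl do rewrite in_setU; apply: ler_sum_predU. Qed.

Lemma ler_sum_has (T : Type) (s : seq T) (hit : T -> pred I) :
  \sum_(i | has (hit^~ i) s) F i <= \sum_(x <- s) \sum_(i | hit x i) F i.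
Proof.
elim: s => [|x s IHs]; first by rewrite big_nil big_pred0.
by rewrite big_cons; apply: le_trans (ler_sum_predU _ _) (lerD (lexx _) IHs).
Qed.

End NonnegativeSums.

Section Flow.
Variables (R : numDomainType) (I : finType) (cost : I -> R).

(* Weighting every unit sent from [A] by the level of its sender plus one, and
   every unit received by the level of its receiver, makes the contribution of
   [A] to both sides differ by exactly the cost of [A]. *)
Lemma saturated_sources_cost_le (x : I -> I -> R) (level : I -> nat)
    (G A : {set I}) :
  (forall a b, 0 <= x a b) ->
  (forall a b, x a b != 0 -> (level a < level b)%N) ->
  (forall b, \sum_a x a b <= cost b) ->
  (forall a, a \in A -> \sum_b x a b = cost a) ->
  (forall a b, a \in A -> x a b != 0 -> b \in G :|: A) ->
  \sum_(a in A) cost a <= \sum_(b in G) cost b *+ level b.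
Proof.
move=> x_ge0 level_lt in_le out_eq out_edge.
have cost_ge0 b : 0 <= cost b by apply: le_trans (in_le b); apply: sumr_ge0.
have weighted : \sum_(a in A) cost a *+ (level a).+1
    <= \sum_(b in G :|: A) cost b *+ level b.
  apply: (@le_trans _ _ (\sum_(b in G :|: A) (\sum_(a in A) x a b) *+ level b)).
    under eq_bigr => a aA do rewrite -out_eq // -sumrMnl.
    under [leRHS]eq_bigr do rewrite -sumrMnl.
    rewrite [leRHS]exchange_big /=; apply: ler_sum => a aA.
    rewrite (bigID (mem (G :|: A))) /= [X in _ + X]big1 ?addr0; last first.
      move=> b bGA; apply/eqP; apply: contraNT bGA.
      by rewrite mulrn_eq0 /= => /(out_edge a b aA).
    apply: ler_sum => b _.
    have [->|/level_lt lt_ab] := eqVneq (x a b) 0; first by rewrite !mul0rn.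
    exact: ler_wpMn2l.
  apply: ler_sum => b _; apply: ler_wMn2r; apply: le_trans (in_le b).
  exact: ler_sum_subpred.
rewrite -(lerD2r (\sum_(a in A) cost a *+ level a)) -big_split /=.
under eq_bigr do rewrite -mulrS.
by apply: le_trans weighted (ler_sum_setU _ _ _) => b; rewrite mulrn_wge0.
Qed.

Lemma flow_cost_le (x : I -> I -> R) (level : I -> nat) (D : nat)
    (G A B : {set I}) :
  (forall a b, 0 <= x a b) ->
  (forall a, (level a < D)%N) ->
  (forall a b, x a b != 0 -> (level a < level b)%N) ->
  (forall b, \sum_a x a b <= cost b) ->
  (forall a, \sum_b x a b <= cost a) ->
  (forall a, a \in A -> \sum_b x a b = cost a) ->
  (forall a b, a \in A -> x a b != 0 -> b \in G :|: A) ->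
  (forall b, b \in B -> \sum_a x a b = cost b) ->
  (forall a b, b \in B -> x a b != 0 -> a \in G :|: B) ->
  \sum_(a in G :|: (A :|: B)) cost a <= D%:R * \sum_(a in G) cost a.
Proof.
move=> x_ge0 level_lt_D level_lt in_le out_le out_eq out_edge in_eq in_edge.
have cost_ge0 b : 0 <= cost b by apply: le_trans (in_le b); apply: sumr_ge0.
have below := saturated_sources_cost_le x_ge0 level_lt in_le out_eq out_edge.
have above : \sum_(b in B) cost b <= \sum_(a in G) cost a *+ (D.-1 - level a).
  apply: (@saturated_sources_cost_le (fun b a => x a b)) => // [b a /level_lt|].
    by have := level_lt_D b; lia.
  by move=> b a; apply: in_edge.
apply: le_trans (ler_sum_setU cost_ge0 _ _) _.
apply: le_trans (lerD (lexx _) (ler_sum_setU cost_ge0 _ _)) _.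
apply: le_trans (lerD (lexx _) (lerD below above)) _.
rewrite -!big_split mulr_sumr; apply: ler_sum => a _ /=.
rewrite -mulrnDr -mulrS mulr_natl (_ : (level a + _).+1 = D) //.
by have := level_lt_D a; lia.
Qed.

End Flow.

Section Tree.
Variables (V : finType) (r : V) (par : V -> V).

Lemma anc_fconnect u v : anc par u v = fconnect par v u.
Proof.
apply/existsP/idP => [[n /eqP<-]|uv]; first exact: fconnect_iter.
have lt : (findex par v u < #|V|)%N.
  exact: leq_trans (findex_max uv) (max_card _).
by exists (Ordinal lt); rewrite /= iter_findex.
Qed.

Lemma anc_refl v : anc par v v.
Proof. by rewrite anc_fconnect connect0. Qed.

Lemma subtree_anc (X : {set V}) v w :
  is_subtree r par X -> w \in X -> anc par v w -> v \in X.
Proof.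
case/andP=> _ /forall_inP parX wX; rewrite anc_fconnect => /iter_findex <-.
by elim: findex => //= n IHn; apply: parX.
Qed.

Definition level (v : V) : nat := findex par v r.

Hypothesis tree : is_rooted_tree r par.

Lemma root_anc v : anc par r v.
Proof.
by have [n nv] := tree.2 v; rewrite anc_fconnect -nv fconnect_iter.
Qed.

Lemma level_lt u v : anc par u v -> u != v -> (level u < level v)%N.
Proof.
rewrite anc_fconnect => /iter_findex <-; move: (findex _ _ _) => n.
elim: n v => [|n IHn] v; first by rewrite eqxx.
rewrite iterSr => neq.
have vr : v != r.
  by apply: contraNneq neq => ->; rewrite tree.1 iter_fix // tree.1.
rewrite {2}/level fconnect_findex -?anc_fconnect ?root_anc // 1?eq_sym // ltnS.
by have [->//|/IHn/ltnW] := eqVneq (iter n par (par v)) (par v).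
Qed.

(* A node of maximal level is a leaf, whose root path has more nodes than its
   level. *)
Lemma level_lt_depth v : (level v < depth par)%N.
Proof.
pose u := [arg max_(u > v) level u].
have u_max w : (level w <= level u)%N.
  by rewrite /u; case: arg_maxnP => // i _; apply.
have u_leaf : leaf par u.
  apply/forallP => w; apply/implyP => /eqP wu; apply: contraT => neq.
  have uw : anc par u w by rewrite anc_fconnect -wu fconnect1.
  by have := level_lt uw; rewrite eq_sym neq ltnNge u_max => /(_ isT).
have root_path_order : #|root_path par u| = order par u.
  by apply: eq_card => w; rewrite inE anc_fconnect.
apply: leq_ltn_trans (u_max v) (leq_trans _ (leq_bigmax_cond _ u_leaf)).
by rewrite root_path_order findex_max // -anc_fconnect root_anc.
Qed.

End Tree.

Lemma setD_chain (T : finType) (A B C : {set T}) :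
  A \subset B -> B \subset C -> C :\: A = (B :\: A) :|: (C :\: B).
Proof.
move=> AB BC; apply/setP => x; rewrite !inE.
have [xA|_] /= := boolP (x \in A); first by rewrite (subsetP AB).
by have [/(subsetP BC) ->|] := boolP (x \in B).
Qed.

Section PriceUpdates.
Variables (R : numDomainType) (V : finType) (c : V -> R).
Implicit Types (S P : {set V}) (p : V -> R) (w : V).

Definition reset P p w : R := if w \in P then c w else p w.

Definition discount P k p w : R := if w \in P then p w * (1 - k) else p w.

(* [price_update S p S1 p1]: prices [p] have become [p1] while the service grew
   from [S] to [S1]. *)
Definition price_update S p S1 p1 : Prop :=
  S \subset S1 /\ forall w,
    if w \in S then p1 w = p w
    else if w \in S1 then p1 w = c w
    else 0 <= p1 w <= p w.

(* A node bought meanwhile has paid its whole price before the reset. *)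
Definition investment S p S1 p1 w : R :=
  p w - (if w \in S1 :\: S then 0 else p1 w).

Lemma price_update_refl S p : (forall w, 0 <= p w) -> price_update S p S p.
Proof.
by move=> p_ge0; split=> // w; case: ifP => // ->; rewrite p_ge0 lexx.
Qed.

Lemma investment_refl S p w : investment S p S p w = 0.
Proof. by rewrite /investment setDv inE subrr. Qed.

Lemma price_update_trans S p S1 p1 S2 p2 :
  price_update S p S1 p1 -> price_update S1 p1 S2 p2 -> price_update S p S2 p2.
Proof.
move=> [sub1 upd1] [sub2 upd2]; split; first exact: subset_trans sub1 sub2.
move=> w; have := upd1 w; have := upd2 w.
have [wS|wS] := boolP (w \in S); first by rewrite (subsetP sub1) // => ->.
have [w1|w1] := boolP (w \in S1); first by rewrite (subsetP sub2) // => ->.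
by case: ifP => // _ /andP[-> le2] /andP[_ le1]; apply: le_trans le1.
Qed.

Lemma investment_trans S p S1 p1 S2 p2 w :
  price_update S p S1 p1 -> price_update S1 p1 S2 p2 ->
  investment S p S2 p2 w = investment S p S1 p1 w + investment S1 p1 S2 p2 w.
Proof.
move=> [sub1 _] [sub2 /(_ w) upd2]; rewrite /investment !inE; move: upd2.
have [wS|wS] := boolP (w \in S); first by rewrite (subsetP sub1) //= => _; ring.
have [w1|w1] /= := boolP (w \in S1); last by move=> _; ring.
by rewrite (subsetP sub2) // => ->; ring.
Qed.

Lemma investment_ge0 S p S1 p1 w :
  (forall w, 0 <= p w) -> price_update S p S1 p1 -> 0 <= investment S p S1 p1 w.
Proof.
move=> p_ge0 [_ /(_ w)]; rewrite /investment inE subr_ge0.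
by case: (w \in S) => /= [-> //|]; case: (w \in S1) => //= /andP[].
Qed.

Lemma price_update_ge0 S p S1 p1 w : (forall w, 0 <= c w) ->
  (forall w, 0 <= p w) -> price_update S p S1 p1 -> 0 <= p1 w.
Proof.
move=> c_ge0 p_ge0 [_ /(_ w)]; case: ifP => [_ -> //|_].
by case: ifP => [_ -> //|_ /andP[]].
Qed.

Lemma price_update_reset S p P : (forall w, 0 <= p w) -> [disjoint P & S] ->
  price_update S p (S :|: P) (reset P p).
Proof.
move=> p_ge0 /disjointFr dis; split=> [|w]; first exact: subsetUl.
rewrite inE /reset; have [wP|_] := boolP (w \in P).
  by rewrite dis // orbT.
by rewrite orbF; case: ifP => // ->; rewrite p_ge0 lexx.
Qed.

Lemma investment_reset S p P w : [disjoint P & S] ->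
  investment S p (S :|: P) (reset P p) w = if w \in P then p w else 0.
Proof.
move=> /disjointFr dis; rewrite /investment !inE /reset.
have [wP|_] := boolP (w \in P); first by rewrite dis // orbT subr0.
by rewrite orbF andNb subrr.
Qed.

Lemma price_update_discount S p P k :
  (forall w, 0 <= p w) -> [disjoint P & S] -> 0 <= k <= 1 ->
  price_update S p S (discount P k p).
Proof.
move=> p_ge0 /disjointFr dis /andP[k_ge0 k_le1]; split=> // w.
rewrite /discount.
have [wP|_] := boolP (w \in P); last first.
  by case: ifP => // ->; rewrite p_ge0 lexx.
by rewrite dis // mulr_ge0 ?subr_ge0 //= ler_piMr // lerBlDr lerDl.
Qed.

Lemma investment_discount S p P k w :
  investment S p S (discount P k p) w = if w \in P then p w * k else 0.
Proof.
rewrite /investment setDv inE /discount.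
by case: ifP => _; [ring | rewrite subrr].
Qed.

End PriceUpdates.

Section Falls.
Variables (R : realFieldType) (V : finType) (par : V -> V).
Variables (c : V -> R) (enq : {set V} -> seq V).
Hypothesis c_gt0 : forall v, 0 < c v.
Implicit Types (v w : V) (S Z : {set V}) (p : V -> R) (b : R).
Implicit Types (q : request R V) (l pend : seq (request R V)).

Definition by_deadline q q' : bool := rdead q <= rdead q'.

Lemma by_deadline_trans : transitive by_deadline.
Proof. by move=> q2 q1 q3; apply: le_trans. Qed.

Definition reached (stop : option R) q : bool :=
  if stop is Some d then rdead q <= d else true.

(* Outcome of the fall of [v] on the requests [l] with budget [b]: it invests
   [y w] in each node [w], and [stop] is the deadline of the request that
   exceeds the budget, or [None] if the fall considers all of [l]. *)
Record fall_spec l v b S1 (y : V -> R) (stop : option R) : Prop := {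
  fall_ge0 : forall w, 0 <= y w;
  fall_sum_le : \sum_w y w <= b;
  fall_sum_stop : stop -> \sum_w y w = b;
  fall_stop_mem : forall d, stop = Some d -> exists2 q, q \in l & rdead q = d;
  fall_support : forall w, y w != 0 -> v != w /\
    exists2 q, q \in l & [/\ anc par v w, anc par w (rnode q)
                           & reached stop q];
  fall_unserved : forall q, q \in l -> anc par v (rnode q) ->
    rnode q \notin S1 -> exists2 d, stop = Some d & d <= rdead q }.

Lemma fall_spec_nil v b S p :
  0 <= b -> fall_spec [::] v b S (investment S p S p) None.
Proof.
move=> b_ge0; split=> // [w||w]; rewrite ?investment_refl ?eqxx //.
by rewrite big1 // => w _; rewrite investment_refl.
Qed.

Section FallStep.
Variables (l : seq (request R V)) (q : request R V) (v : V) (b : R).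
Variables (S : {set V}) (p : V -> R).
Hypothesis l_sorted : sorted by_deadline (q :: l).
Hypothesis vS : v \in S.
Hypothesis p_ge0 : forall w, 0 <= p w.

Let P := path_set par v (rnode q) :\: S.

Lemma rdead_head_le q' : q' \in q :: l -> rdead q <= rdead q'.
Proof.
rewrite inE => /predU1P[->//|].
by move: l_sorted => /= /(order_path_min by_deadline_trans)/allP; apply.
Qed.

Lemma missing_path_anc w :
  w \in P -> [/\ v != w, anc par v w & anc par w (rnode q)].
Proof.
by rewrite !inE => /and3P[wS vw wq]; split=> //; apply: contraNneq wS => <-.
Qed.

Lemma fall_spec_stop (a := set_cost p P) : 0 <= b -> b < a ->
  fall_spec (q :: l) v b S (investment S p S (discount P (b / a) p))
    (Some (rdead q)).
Proof.
move=> b_ge0 b_lt; have a_gt0 : 0 < a by apply: le_lt_trans b_lt.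
have ba_ge0 : 0 <= b / a by rewrite divr_ge0 // ltW.
have sum_eq : \sum_w investment S p S (discount P (b / a) p) w = b.
  under eq_bigr do rewrite investment_discount.
  by rewrite -big_mkcond -mulr_suml mulrC divfK // gt_eqF.
split=> //.
- by move=> w; rewrite investment_discount; case: ifP => // _; rewrite mulr_ge0.
- by rewrite sum_eq.
- by move=> d [<-]; exists q; rewrite ?mem_head.
- move=> w; rewrite investment_discount; case: ifPn => [wP _|_]; last first.
    by rewrite eqxx.
  have [neq vw wq] := missing_path_anc wP; split=> //.
  by exists q; rewrite /reached ?mem_head ?lexx.
- by move=> q' q'l _ _; exists (rdead q); rewrite ?rdead_head_le.
Qed.

Lemma fall_spec_buy S1 p1 stop (a := set_cost p P) :
  price_update c (S :|: P) (reset c P p) S1 p1 ->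
  fall_spec l v (b - a) S1 (investment (S :|: P) (reset c P p) S1 p1) stop ->
  fall_spec (q :: l) v b S1 (investment S p S1 p1) stop.
Proof.
move=> upd1 fall.
have dis : [disjoint P & S] by rewrite disjoints_subset subsetDr.
have upd0 := price_update_reset c p_ge0 dis.
have invE w : investment S p S1 p1 w
    = (if w \in P then p w else 0) + investment (S :|: P) (reset c P p) S1 p1 w.
  by rewrite (investment_trans _ upd0 upd1) investment_reset.
have sum_eq : \sum_w investment S p S1 p1 w
    = a + \sum_w investment (S :|: P) (reset c P p) S1 p1 w.
  by under eq_bigr do rewrite invE; rewrite big_split -big_mkcond.
have q_reached : reached stop q.
  rewrite /reached; case stopE: stop => [d|//].
  have [q' q'l <-] := fall_stop_mem fall stopE.
  by rewrite rdead_head_le // inE q'l orbT.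
split.
- by move=> w; apply: investment_ge0 p_ge0 (price_update_trans upd0 upd1).
- by rewrite sum_eq -lerBrDl (fall_sum_le fall).
- by rewrite sum_eq => /(fall_sum_stop fall) ->; rewrite addrC subrK.
- move=> d /(fall_stop_mem fall)[q' q'l <-].
  by exists q'; rewrite // inE q'l orbT.
- move=> w; rewrite invE; have [wP _|_] := ifPn.
    have [neq vw wq] := missing_path_anc wP; split=> //.
    by exists q; rewrite ?mem_head.
  rewrite add0r => /(fall_support fall)[neq [q' q'l anc_reached]]; split=> //.
  by exists q'; rewrite // inE q'l orbT.
- move=> q'; rewrite inE => /predU1P[->|]; last exact: fall_unserved fall _.
  move=> vq /negP[]; apply: (subsetP upd1.1); rewrite !inE vq anc_refl /= andbT.
  exact: orbN.
Qed.

End FallStep.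

Lemma vfall_loop_spec v l S p b A :
  sorted by_deadline l -> v \in S -> (forall w, 0 <= p w) -> 0 <= b ->
  let: (S1, p1, A1) := vfall_loop par c v l S p b A in
  [/\ price_update c S p S1 p1, A1 = A :|: (S1 :\: S)
    & exists stop, fall_spec l v b S1 (investment S p S1 p1) stop].
Proof.
elim: l S p b A => [|q l IHl] S p b A l_sorted vS p_ge0 b_ge0 /=.
  rewrite setDv setU0; split=> //; first exact: price_update_refl.
  by exists None; apply: fall_spec_nil.
set P := path_set par v (rnode q) :\: S; set a := set_cost p P.
have dis : [disjoint P & S] by rewrite disjoints_subset subsetDr.
case: ltP => [b_lt|a_le].
  have a_gt0 : 0 < a by apply: le_lt_trans b_lt.
  rewrite setDv setU0; split=> //.
    apply: price_update_discount => //.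
    by rewrite divr_ge0 ?(ltW a_gt0) // ler_pdivrMr // mul1r ltW.
  by exists (Some (rdead q)); apply: fall_spec_stop.
have upd0 := price_update_reset c p_ge0 dis.
have := IHl (S :|: P) (reset c P p) (b - a) (A :|: P) (path_sorted l_sorted).
rewrite /reset; case: vfall_loop => [[S1 p1] A1] [].
- by rewrite inE vS.
- by move=> w; apply: price_update_ge0 p_ge0 upd0 => u; apply: ltW.
- by rewrite subr_ge0.
move=> upd1 -> [stop fall]; split; first exact: price_update_trans upd0 upd1.
  rewrite (setD_chain upd0.1 upd1.1) setDUl setDv set0U.
  by rewrite setDDl setUid setUA.
by exists stop; apply: fall_spec_buy.
Qed.

Lemma fall_spec_filter pend v b S1 y stop :
  fall_spec [seq q <- pend | anc par v (rnode q)] v b S1 y stop ->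
  fall_spec pend v b S1 y stop.
Proof.
case=> y_ge0 y_le y_stop stop_mem y_supp unserved; split=> //.
- by move=> d /stop_mem[q]; rewrite mem_filter => /andP[_ qp]; exists q.
- move=> w /y_supp[neq [q]]; rewrite mem_filter => /andP[_ qp] q_anc.
  by split=> //; exists q.
- by move=> q qp vq; apply: unserved; rewrite // mem_filter vq.
Qed.

Lemma fall_spec_sub pend v b S1 S2 y stop : S1 \subset S2 ->
  fall_spec pend v b S1 y stop -> fall_spec pend v b S2 y stop.
Proof.
move=> sub [? ? ? ? ? unserved]; split=> // q qp vq qS2; apply: unserved => //.
by apply: contraNN qS2; apply: (subsetP sub).
Qed.

Lemma vfall_spec pend v S p :
  sorted by_deadline pend -> v \in S -> (forall w, 0 <= p w) ->
  let: (S1, p1, A) := vfall par c pend v S p in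
  [/\ price_update c S p S1 p1, A = S1 :\: S
    & exists stop, fall_spec pend v (c v) S1 (investment S p S1 p1) stop].
Proof.
move=> pend_sorted vS p_ge0; rewrite /vfall; set l := filter _ _.
have l_sorted : sorted by_deadline l.
  exact: sorted_filter by_deadline_trans _ _ pend_sorted.
have := vfall_loop_spec set0 l_sorted vS p_ge0 (ltW (c_gt0 v)).
case: vfall_loop => [[S1 p1] A] [upd -> [stop fall]]; split=> //.
  by rewrite set0U.
by exists stop; apply: fall_spec_filter.
Qed.

(* [Z] is the queue at the start, so the falls of the nodes in
   [Z :|: (S1 :\: S)] are run; the fall of [v] invests [x v w] in [w]. *)
Record service_spec pend Z S p S1 p1 (x : V -> V -> R) (stop : V -> option R) :
    Prop := {
  serv_update : price_update c S p S1 p1;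
  serv_in : forall w, \sum_v x v w = investment S p S1 p1 w;
  serv_fall : forall v, v \in Z :|: (S1 :\: S) ->
    fall_spec pend v (c v) S1 (x v) (stop v);
  serv_idle : forall v w, v \notin Z :|: (S1 :\: S) -> x v w = 0 }.

Lemma service_spec_nil pend S p : (forall w, 0 <= p w) ->
  service_spec pend set0 S p S p (fun _ _ => 0) (fun=> None).
Proof.
move=> p_ge0; split=> //; first exact: price_update_refl.
  by move=> w; rewrite big1 // investment_refl.
by move=> v; rewrite setDv setU0 inE.
Qed.

Lemma service_spec_cons pend v Z S p S' p' S1 p1 x stop d :
  v \in S -> v \notin Z -> price_update c S p S' p' ->
  fall_spec pend v (c v) S' (investment S p S' p') d ->
  service_spec pend (Z :|: (S' :\: S)) S' p' S1 p1 x stop ->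
  service_spec pend (v |: Z) S p S1 p1
    (fun u => if u == v then investment S p S' p' else x u)
    (fun u => if u == v then d else stop u).
Proof.
move=> vS vZ upd fall [upd1 x_in x_fall x_idle].
have [sub sub1] := (upd.1, upd1.1).
have fallersE : (v |: Z) :|: (S1 :\: S)
    = v |: (Z :|: (S' :\: S) :|: (S1 :\: S')).
  by rewrite -!setUA (setD_chain sub sub1).
have v_idle : v \notin Z :|: (S' :\: S) :|: (S1 :\: S').
  by rewrite !inE (subsetP sub) // vS (negbTE vZ).
split; first exact: price_update_trans upd upd1.
- move=> w; rewrite (investment_trans _ upd upd1) -x_in (bigD1 v) //= eqxx.
  rewrite [in RHS](bigD1 v) //= x_idle // add0r; congr (_ + _).
  by apply: eq_bigr => u /negbTE ->.
- move=> u; rewrite fallersE in_setU1; case: eqVneq => [-> _|_].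
    exact: fall_spec_sub sub1 fall.
  exact: x_fall.
- by move=> u w; rewrite fallersE in_setU1; case: eqVneq => // _; apply: x_idle.
Qed.

Hypothesis enqP : forall X : {set V}, perm_eq (enq X) (enum X).

Lemma mem_enq X v : (v \in enq X) = (v \in X).
Proof. by rewrite (perm_mem (enqP X)) mem_enum. Qed.

Lemma enq_uniq X : uniq (enq X).
Proof. by rewrite (perm_uniq (enqP X)) enum_uniq. Qed.

Lemma size_enq X : size (enq X) = #|X|.
Proof. by rewrite (perm_size (enqP X)) cardE. Qed.

(* Every node dequeued later is in [Q] already or still to be bought, whence the
   bound on the fuel [n]. *)
Lemma queue_loop_spec pend n (Q : seq V) S p :
  sorted by_deadline pend -> (forall w, 0 <= p w) ->
  uniq Q -> {subset Q <= S} -> (size Q + #|~: S| <= n)%N ->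
  let: (S1, p1) := queue_loop par c enq pend n Q S p in
  exists x stop, service_spec pend [set v in Q] S p S1 p1 x stop.
Proof.
move=> pend_sorted; have done_spec S' p' : (forall w, 0 <= p' w) ->
    exists x stop, service_spec pend [set v in [::]] S' p' S' p' x stop.
  by move=> p'_ge0; rewrite set_nil; do 2!eexists; apply: service_spec_nil.
elim: n Q S p => [|n IHn] [|v Q] S p p_ge0 //=.
- by move=> _ _ _; apply: done_spec.
- by move=> _ _ _; apply: done_spec.
move=> /andP[vQ Q_uniq] QS size_le.
have vS : v \in S by apply: QS; rewrite mem_head.
have {}QS : {subset Q <= S} by move=> w wQ; apply: QS; rewrite inE wQ orbT.
have := vfall_spec pend_sorted vS p_ge0.
case: vfall => [[S' p'] A] [upd -> [d fall]]; have sub := upd.1.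
have := IHn (Q ++ enq (S' :\: S)) S' p'.
case: queue_loop => [S1 p1] /(_ _ _ _ _)[].
- by move=> w; apply: price_update_ge0 p_ge0 upd => u; apply: ltW.
- rewrite cat_uniq Q_uniq enq_uniq andbT /=; apply/hasPn => w.
  by rewrite mem_enq inE => /andP[wS _]; apply: contraNN wS => /QS.
- move=> w; rewrite mem_cat mem_enq inE => /orP[/QS|/andP[]//].
  exact: (subsetP sub).
- rewrite size_cat size_enq.
  have := cardsC S; have := cardsC S'; have := cardsD S' S.
  have := subset_leq_card sub; rewrite (setIidPr sub).
  by move: size_le => /=; lia.
move=> x [stop rest]; rewrite set_cons; do 2!eexists.
apply: service_spec_cons vS _ upd fall _; first by rewrite inE.
rewrite (_ : _ :|: _ = [set w in Q ++ enq (S' :\: S)]) //; first exact: rest.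
by apply/setP => w; rewrite !inE mem_cat mem_enq !inE.
Qed.

End Falls.

Section Runs.
Variables (R : realFieldType) (V : finType) (par : V -> V).
Variables (c : V -> R) (enq : {set V} -> seq V).
Variables (reqs : seq (request R V)) (t0 : R).

Record log_entry : Type := LogEntry {
  log_set : {set V};
  log_time : R;
  log_path : {set V};
  log_price : V -> R;
  log_invest : V -> V -> R;
  log_stop : V -> option R }.

(* A fictitious service of all nodes at a time [t0] before every arrival, which
   provides every node with a first item. *)
Definition initial_entry : log_entry :=
  LogEntry [set: V] t0 set0 c (fun _ _ => 0) (fun=> None).

Definition satisfied (trans : seq (service R V)) (q : request R V) : bool :=
  has (fun s => satisfies s q) trans.

Lemma satisfied_rcons trans s q :
  satisfied (rcons trans s) q = satisfies s q || satisfied trans q.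
Proof. exact: has_rcons. Qed.

Definition pending_at (trans : seq (service R V)) (t : R) : seq (request R V) :=
  [seq q <- reqs | pending trans t q].

Record service_step (trans : seq (service R V)) (prev next : log_entry)
    (pend := pending_at trans (log_time next)) : Prop := {
  step_time : log_time prev < log_time next;
  step_earliest : forall q, q \in pend -> log_time next <= rdead q;
  step_trigger : exists2 rho, rho \in pend &
    rdead rho = log_time next /\ log_path next = root_path par (rnode rho);
  step_service : service_spec par c pend (log_path next)
    (log_path next) (reset c (log_path next) (log_price prev))
    (log_set next) (log_price next) (log_invest next) (log_stop next) }.

Definition transmissions (e : nat -> log_entry) (n : nat) : seq (service R V) :=
  [seq (log_set (e i.+1), log_time (e i.+1)) | i <- iota 0 n].

Definition requests_at (e : nat -> log_entry) (i : nat) : seq (request R V) :=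
  pending_at (transmissions e i.-1) (log_time (e i)).

Record run (m : nat) (e : nat -> log_entry) : Prop := {
  run_init : e 0 = initial_entry;
  run_step : forall i, (i < m)%N ->
    service_step (transmissions e i) (e i) (e i.+1) }.

Definition extend (m : nat) (e : nat -> log_entry) (l : log_entry) (i : nat) :
    log_entry :=
  if (i <= m)%N then e i else l.

Lemma eq_transmissions e e' n :
  (forall i, (i <= n)%N -> e i = e' i) ->
  transmissions e n = transmissions e' n.
Proof.
move=> ee'; apply/eq_in_map => i; rewrite mem_iota add0n => /andP[_ i_lt].
by rewrite ee'.
Qed.

Lemma transmissions_extend m e l :
  transmissions (extend m e l) m.+1
  = rcons (transmissions e m) (log_set l, log_time l).
Proof.
rewrite -(@eq_transmissions (extend m e l)) => [|i im].
  by rewrite /transmissions -addn1 iotaD map_cat cats1 add0n {3 4}/extend ltnn.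
by rewrite /extend im.
Qed.

Lemma run_extend m e l :
  run m e -> service_step (transmissions e m) (e m) l ->
  run m.+1 (extend m e l).
Proof.
move=> [e0 steps] step; split=> // i; rewrite ltnS => im.
have old k : (k <= m)%N -> extend m e l k = e k by rewrite /extend => ->.
rewrite (@eq_transmissions _ e) => [|k ki]; last exact/old/(leq_trans ki).
rewrite old //; case: (ltnP i m) => [lt|mi].
  by rewrite old //; apply: steps.
by rewrite (@anti_leq i m) ?im // /extend ltnn.
Qed.

Section RunFacts.
Variables (m : nat) (e : nat -> log_entry).
Hypothesis c_gt0 : forall v, 0 < c v.
Hypothesis run_e : run m e.

Lemma run_time_le i j : (i <= j <= m)%N -> log_time (e i) <= log_time (e j).
Proof.
elim: j => [|j IHj]; first by rewrite leqn0 => /andP[/eqP->].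
case/andP; rewrite leq_eqVlt => /predU1P[->//|ij] jm.
apply: le_trans (ltW (step_time (run_step run_e jm))); apply: IHj.
by rewrite -ltnS ij ltnW.
Qed.

Lemma run_price_ge0 j w : (j <= m)%N -> 0 <= log_price (e j) w.
Proof.
elim: j w => [|j IHj] w jm; first by rewrite (run_init run_e) ltW.
apply: price_update_ge0 (serv_update (step_service (run_step run_e jm))) => u.
  exact: ltW.
by rewrite /reset; case: ifP => _; [apply: ltW | apply/IHj/ltnW].
Qed.

Lemma run_price_served j w :
  (j <= m)%N -> w \in log_set (e j) -> log_price (e j) w = c w.
Proof.
case: j => [_|j jm] wS; first by rewrite (run_init run_e).
have [_ /(_ w)] := serv_update (step_service (run_step run_e jm)).
by rewrite wS /reset; case: (w \in log_path _).
Qed.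

Lemma run_received i w : (i < m)%N ->
  \sum_v log_invest (e i.+1) v w =
    if w \in log_set (e i.+1)
    then if w \in log_path (e i.+1) then 0 else log_price (e i) w
    else log_price (e i) w - log_price (e i.+1) w.
Proof.
move=> im; have step := step_service (run_step run_e im).
have [sub /(_ w)] := serv_update step; rewrite (serv_in step).
rewrite /investment inE /reset; have := subsetP sub w.
case: (w \in log_path _) => [-> // ->|_]; first by rewrite subrr.
by case: (w \in _) => //= _; rewrite subr0.
Qed.

Lemma run_fall i v : (0 < i <= m)%N -> v \in log_set (e i) ->
  fall_spec par (requests_at e i) v (c v) (log_set (e i)) (log_invest (e i) v)
    (log_stop (e i) v).
Proof.
case: i => // i im vS; apply: (serv_fall (step_service (run_step run_e im))).
by rewrite !inE vS andbT orbN.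
Qed.

Lemma run_idle i v w : (i <= m)%N -> ~~ ((0 < i)%N && (v \in log_set (e i))) ->
  log_invest (e i) v w = 0.
Proof.
case: i => [|i] im /= vS; first by rewrite (run_init run_e).
have step := step_service (run_step run_e im); apply: (serv_idle step).
rewrite !inE negb_or andbC (negbTE vS) andbF /=.
by apply: contraNN vS; apply: (subsetP (serv_update step).1).
Qed.

(* [q] was already pending at service [j], which came before its deadline but
   did not satisfy it, so the fall of [w] stopped at [q] or earlier. *)
Lemma run_stop i j q w : (j < i <= m)%N -> t0 < rarr q ->
  q \in requests_at e i -> rarr q <= log_time (e j) ->
  w \in log_set (e j) -> anc par w (rnode q) ->
  exists2 d, log_stop (e j) w = Some d & d <= rdead q.
Proof.
case: i j => // i [|j] /andP[ji im] arr.
  by rewrite (run_init run_e) leNgt arr.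
move=> qp qt wS wq; have := step_earliest (run_step run_e im) qp.
move: qp; rewrite mem_filter => /andP[/andP[_ unsat] qr] qdead.
have unsat_at k : (k <= i)%N -> ~~ satisfied (transmissions e k) q.
  move=> ki; apply: contraNN unsat => /hasP[s sk sq].
  apply/hasP; exists s => //.
  by rewrite /transmissions -(subnKC ki) iotaD map_cat mem_cat sk.
have jm : (j < m)%N by apply: leq_trans (ltnW ji) im.
apply: (fall_unserved (run_fall (i := j.+1) jm wS)) => //.
  by rewrite mem_filter qr andbT /pending qt unsat_at // ltnW.
apply: contraNN (unsat_at j.+1 ji) => qS; apply/hasP.
exists (log_set (e j.+1), log_time (e j.+1)).
  by apply: map_f; rewrite mem_iota /=.
rewrite /satisfies qS qt; apply: le_trans qdead.
by apply: run_time_le; rewrite (ltnW ji).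
Qed.

End RunFacts.

Hypothesis c_gt0 : forall v, 0 < c v.
Hypothesis enqP : forall X : {set V}, perm_eq (enq X) (enum X).
Hypothesis t0_lt : forall q, q \in reqs -> t0 < rarr q.
Hypothesis arr_le : forall q, q \in reqs -> rarr q <= rdead q.
Hypothesis reqs_sorted :
  sorted (fun q q' : request R V => rdead q < rdead q') reqs.

Lemma wf_step_service m e rho (trans := transmissions e m)
    (pend := pending_at trans (rdead rho)) :
  run m e -> rho \in pend -> log_time (e m) < rdead rho ->
  (forall q, q \in pend -> rdead rho <= rdead q) ->
  exists l, [/\ service_step trans (e m) l, log_time l = rdead rho,
    rnode rho \in log_set l
    & wf_step par c enq reqs (trans, log_price (e m)) rho
      = (rcons trans (log_set l, log_time l), log_price l)].
Proof.
move=> run_e rho_pend time_lt earliest; set P := root_path par (rnode rho).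
have pend_sorted : sorted (@by_deadline R V) pend.
  apply: sorted_filter; first exact: by_deadline_trans.
  by apply: sub_sorted reqs_sorted => q q'; apply: ltW.
have reset_ge0 w : 0 <= reset c P (log_price (e m)) w.
  rewrite /reset; case: ifP => _; first exact: ltW.
  exact: (run_price_ge0 c_gt0 run_e).
rewrite /wf_step; move: (rho_pend); rewrite mem_filter => /andP[-> _].
have := queue_loop_spec par c_gt0 enqP (n := #|V|) (Q := enq P) (S := P)
  pend_sorted reset_ge0 (enq_uniq enqP P).
rewrite -/P -/pend /reset; case: queue_loop => [S1 p1] [||x [stop spec]].
- by move=> w; rewrite mem_enq.
- by rewrite size_enq // cardsC.
exists (LogEntry S1 (rdead rho) P p1 x stop); split=> //=; last first.
  by apply: (subsetP (serv_update spec).1); rewrite inE anc_refl.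
split=> //=; first by exists rho.
by rewrite -[X in service_spec _ _ _ X](_ : [set v in enq P] = P) //;
  apply/setP => w; rewrite inE mem_enq.
Qed.

Definition wf_invariant (treated untreated : seq (request R V))
    (st : seq (service R V) * (V -> R)) : Prop :=
  exists m e, [/\ run m e, st = (transmissions e m, log_price (e m)),
    forall q, q \in treated -> satisfied st.1 q
    & forall q, q \in untreated -> log_time (e m) < rdead q].

Lemma wf_step_invariant treated rho untreated st :
  reqs = treated ++ rho :: untreated ->
  wf_invariant treated (rho :: untreated) st ->
  wf_invariant (rcons treated rho) untreated (wf_step par c enq reqs st rho).
Proof.
move=> reqsE [m [e [run_e -> sat time_lt]]]; rewrite /= in sat.
have rho_reqs : rho \in reqs by rewrite reqsE mem_cat mem_head orbT.
have rho_lt q : q \in untreated -> rdead rho < rdead q.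
  have tr : transitive (fun q q' : request R V => rdead q < rdead q').
    by move=> q2 q1 q3; apply: lt_trans.
  move: reqs_sorted; rewrite reqsE sorted_pairwise // pairwise_cat.
  by rewrite pairwise_cons => /and3P[_ _ /andP[/allP lt _]]; apply: lt.
have earliest q : q \in pending_at (transmissions e m) (rdead rho) ->
    rdead rho <= rdead q.
  rewrite mem_filter reqsE mem_cat inE => /andP[/andP[_ /negP unsat]].
  by case/or3P => [/sat//|/eqP->//|/rho_lt/ltW].
case: (boolP (pending (transmissions e m) (rdead rho) rho)) => [pend_rho|].
  have rho_pend : rho \in pending_at (transmissions e m) (rdead rho).
    by rewrite mem_filter pend_rho.
  have [l [step tl rhoS ->]] :=
    wf_step_service run_e rho_pend (time_lt _ (mem_head _ _)) earliest.
  exists m.+1, (extend m e l); split; first exact: run_extend.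
  - by rewrite transmissions_extend /extend ltnn.
  - move=> q; rewrite mem_rcons inE satisfied_rcons => /predU1P[->|/sat ->].
      by rewrite /satisfies tl rhoS lexx arr_le.
    by rewrite orbT.
  - by move=> q qu; rewrite /extend ltnn tl; apply: rho_lt.
rewrite /wf_step => npend; rewrite (negbTE npend); exists m, e; split=> //=.
  move=> q; rewrite mem_rcons inE => /predU1P[->|/sat//].
  by move: npend; rewrite /pending arr_le // negbK.
by move=> q qu; apply: time_lt; rewrite inE qu orbT.
Qed.

Lemma foldl_wf_invariant treated untreated st :
  reqs = treated ++ untreated -> wf_invariant treated untreated st ->
  wf_invariant reqs [::] (foldl (wf_step par c enq reqs) st untreated).
Proof.
elim: untreated treated st => [|rho untreated IH] treated st reqsE inv /=.
  by rewrite {1}reqsE cats0.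
apply: (IH (rcons treated rho)); first by rewrite cat_rcons.
exact: wf_step_invariant inv.
Qed.

Lemma waterfall_run : exists m e, run m e /\
  transmissions e m = (foldl (wf_step par c enq reqs) ([::], c) reqs).1.
Proof.
have inv0 : wf_invariant [::] reqs ([::], c).
  exists 0%N, (fun=> initial_entry); split=> // q qr.
  exact: lt_le_trans (t0_lt qr) (arr_le qr).
have [m [e [run_e -> _ _]]] :=
  foldl_wf_invariant (erefl : reqs = [::] ++ reqs) inv0.
by exists m, e.
Qed.

End Runs.

Section PreviousService.
Variables (V : finType) (S : nat -> {set V}).

(* Only services strictly before [i] count; 0 if none of them contains [w]. *)
Fixpoint prev_service (i : nat) (w : V) : nat :=
  if i is j.+1 then if w \in S j then j else prev_service j w else 0.

Lemma prev_serviceS i w :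
  prev_service i.+1 w = if w \in S i then i else prev_service i w.
Proof. by []. Qed.

Lemma prev_service_le i w : (prev_service i w <= i.-1)%N.
Proof. by elim: i => //= i IHi; case: ifP => // _; lia. Qed.

Lemma prev_service_max i j w :
  w \in S j -> (j < i)%N -> (j <= prev_service i w)%N.
Proof.
move=> wj; elim: i => // i IHi; rewrite ltnS leq_eqVlt /=.
case/predU1P => [<-|ji]; first by rewrite wj.
by case: ifP => _; [apply: ltnW | apply: IHi].
Qed.

Hypothesis S0 : S 0 = [set: V].

Lemma prev_service_mem i w : w \in S (prev_service i w).
Proof. by elim: i => [|i IHi] /=; [rewrite S0 inE | case: ifP]. Qed.

Lemma sum_ended_items (R : zmodType) (m : nat) (F : V -> R) :
  \sum_(a : 'I_m.+1 * V
      | (a.2 \in S a.1) && (a.1 != prev_service m.+1 a.2 :> nat)) F a.2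
  = \sum_(i < m) \sum_(w in S i.+1) F w.
Proof.
under [RHS]eq_bigr do rewrite big_mkcond.
rewrite [RHS]exchange_big big_mkcond /=.
rewrite -(pair_bigA _ (fun (j : 'I_m.+1) w =>
  if (w \in S j) && (j != prev_service m.+1 w :> nat) then F w else 0)).
rewrite exchange_big; apply: eq_bigr => w _ /=; apply: (@addrI _ (F w)).
transitivity (\sum_(j < m.+1 | w \in S j) F w).
  have last_lt : (prev_service m.+1 w < m.+1)%N.
    by rewrite ltnS prev_service_le.
  rewrite [RHS](bigD1 (Ordinal last_lt)) ?prev_service_mem //=.
  by rewrite -[in LHS]big_mkcond.
by rewrite big_mkcond big_ord_recl S0 inE.
Qed.

End PreviousService.

Section Accounting.
Variables (R : realFieldType) (V : finType) (r : V) (par : V -> V).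
Variables (c : V -> R) (reqs : seq (request R V)) (t0 : R).
Variables (m : nat) (e : nat -> log_entry R V) (sched : seq (service R V)).
Hypothesis tree : is_rooted_tree r par.
Hypothesis c_gt0 : forall v, 0 < c v.
Hypothesis t0_lt : forall q, q \in reqs -> t0 < rarr q.
Hypothesis run_e : run par c reqs t0 m e.
Hypothesis feas : feasible r par reqs sched.

Let S j := log_set (e j).
Let t j := log_time (e j).
Local Notation prev := (prev_service S).

Let S0 : S 0 = [set: V].
Proof. by rewrite /S (run_init run_e). Qed.

Definition received (n j : nat) (w : V) : R :=
  \sum_(i < n.+1 | prev i w == j) \sum_v log_invest (e i) v w.

Lemma received0 j w : received 0 j w = 0.
Proof.
rewrite /received big_mkcond big_ord1 (run_init run_e) big1 //.
by case: ifP.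
Qed.

Lemma receivedS n j w : received n.+1 j w =
  received n j w
  + (if prev n.+1 w == j then \sum_v log_invest (e n.+1) v w else 0).
Proof. by rewrite /received !(big_mkcond (fun i => _ == j)) big_ord_recr. Qed.

Lemma received_current n w : (n <= m)%N ->
  received n (prev n.+1 w) w = c w - log_price (e n) w.
Proof.
elim: n => [|n IHn] nm; first by rewrite received0 (run_init run_e) subrr.
have [wS|wS] := boolP (w \in S n.+1); last first.
  rewrite prev_serviceS (negbTE wS) receivedS eqxx.
  by rewrite IHn ?(ltnW nm) // (run_received run_e _ nm) (negbTE wS); ring.
rewrite (run_price_served run_e nm wS) subrr prev_serviceS wS.
rewrite /received big_pred0 // => i; have := prev_service_le S i w.
by have := ltn_ord i; lia.
Qed.

Lemma received_le n j w : (n <= m)%N -> received n j w <= c w.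
Proof.
elim: n => [|n IHn] nm; first by rewrite received0 ltW.
rewrite receivedS; case: eqP => [<-|_]; last by rewrite addr0 IHn // ltnW.
rewrite received_current ?(ltnW nm) // (run_received run_e _ nm).
have pn := run_price_ge0 c_gt0 run_e w (ltnW nm).
have pn1 := run_price_ge0 c_gt0 run_e w nm.
by case: ifP => _; first case: ifP => _; lra.
Qed.

Lemma received_ended n j w : (n <= m)%N ->
  w \in S j -> (j < prev n.+1 w)%N ->
  (forall i, (i < n)%N -> prev i.+1 w = j -> w \notin log_path (e i.+1)) ->
  received n j w = c w.
Proof.
move=> + wj; elim: n => [|n IHn] nm j_lt not_on_path.
  by have := prev_service_le S 1 w; lia.
rewrite receivedS; have [jE|neq] := eqVneq (prev n.+1 w) j.
  have wS : w \in S n.+1.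
    apply: contraLR j_lt; rewrite prev_serviceS jE => /negbTE->.
    by rewrite ltnn.
  rewrite -{1}jE received_current ?(ltnW nm) // (run_received run_e _ nm).
  by rewrite -/(S n.+1) wS (negbTE (not_on_path n _ jE)) // subrK.
rewrite addr0; apply: IHn => [||i i_lt]; first exact: ltnW.
  rewrite ltn_neqAle eq_sym neq prev_service_max //.
  exact: leq_trans j_lt (prev_service_le S n.+2 w).
by apply: not_on_path; apply: ltnW.
Qed.

Local Notation item := ('I_m.+1 * V)%type.
Implicit Types a b : item.

Definition flow a b : R :=
  if prev a.1 b.2 == b.1 then log_invest (e a.1) a.2 b.2 else 0.

Lemma flow_in b : \sum_a flow a b = received m b.1 b.2.
Proof.
rewrite -(pair_bigA _ (fun i v => flow (i, v) b)) /received [RHS]big_mkcond.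
by apply: eq_bigr => i _; rewrite /flow /=; case: ifP => // _; rewrite big1.
Qed.

Lemma flow_out a : \sum_b flow a b = \sum_w log_invest (e a.1) a.2 w.
Proof.
rewrite -(pair_bigA _ (fun j w => flow a (j, w))) exchange_big /=.
apply: eq_bigr => w _; rewrite /flow /=.
have prev_lt : (prev a.1 w < m.+1)%N.
  by have := prev_service_le S a.1 w; have := ltn_ord a.1; lia.
by rewrite -big_mkcond (big_pred1 (Ordinal prev_lt)) // => j; rewrite eq_sym.
Qed.

Lemma flow_ge0 a b : 0 <= flow a b.
Proof.
rewrite /flow; case: ifP => // _; case: a => [[i im] v] /=.
have [/andP[i_gt0 vS]|idle] := boolP ((0 < i)%N && (v \in S i)).
  by apply: fall_ge0 (run_fall run_e _ vS) _; rewrite i_gt0.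
by rewrite (run_idle run_e).
Qed.

Lemma flow_out_le a : \sum_b flow a b <= c a.2.
Proof.
rewrite flow_out; case: a => [[i im] v] /=.
have [/andP[i_gt0 vS]|idle] := boolP ((0 < i)%N && (v \in S i)).
  by apply: fall_sum_le (run_fall run_e _ vS); rewrite i_gt0.
by rewrite big1 ?ltW // => w _; rewrite (run_idle run_e).
Qed.

Lemma flow_support a b : flow a b != 0 ->
  [/\ (0 < a.1)%N, prev a.1 b.2 = b.1, a.2 \in S a.1, a.2 != b.2
    & exists2 q, q \in requests_at reqs e a.1 & [/\ anc par a.2 b.2,
        anc par b.2 (rnode q) & reached (log_stop (e a.1) a.2) q]].
Proof.
rewrite /flow; case: ifPn => [/eqP prevE|_]; last by rewrite eqxx.
case: a prevE => [[i im] v] /= prevE.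
have [/andP[i_gt0 vS]|idle] := boolP ((0 < i)%N && (v \in S i)); last first.
  by rewrite (run_idle run_e) ?eqxx.
have i_range : (0 < i <= m)%N by rewrite i_gt0.
by move=> /(fall_support (run_fall run_e i_range vS))[neq ?]; split.
Qed.

Definition served (v : V) (x y : R) : bool :=
  has (fun s : service R V => (v \in s.1) && (x < s.2 <= y)) sched.

Lemma served_anc v w x y : anc par v w -> served w x y -> served v x y.
Proof.
move=> vw /hasP[s ss /andP[ws st]]; apply/hasP; exists s => //.
by rewrite (subtree_anc (feas.1 s ss) ws vw).
Qed.

Lemma served_widen v x y z : y <= z -> served v x y -> served v x z.
Proof.
move=> yz /hasP[s ss /and3P[vs sx sy]]; apply/hasP; exists s => //.
by rewrite vs sx (le_trans sy).
Qed.

Lemma served_split v x y z : served v x z -> served v x y || served v y z.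
Proof.
move=> /hasP[s ss /and3P[vs sx sz]].
by case: (leP s.2 y) => sy; apply/orP; [left | right]; apply/hasP; exists s;
  rewrite // vs ?sx ?sy.
Qed.

Definition hits (s : service R V) (j : nat) (v : V) : bool :=
  [&& v \in S j, v \in s.1, t j < s.2 &
      [forall k : 'I_m.+1, (j < k)%N && (v \in S k) ==> (s.2 <= t k)]].

Definition good (j : nat) (v : V) : bool := has (fun s => hits s j v) sched.

Definition down (j : nat) (v : V) : bool :=
  [&& v \in S j, ~~ good j v
    & if log_stop (e j) v is Some d then ~~ served v (t j) d else false].

Definition up (j : nat) (v : V) : bool :=
  [&& v \in S j, ~~ good j v, ~~ down j v & j != prev m.+1 v].

Lemma served_good i w x : (forall k, (i <= k <= m)%N -> x <= t k) ->
  served w (t (prev i w)) x -> good (prev i w) w.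
Proof.
move=> x_le /hasP[s ss /and3P[ws sj sx]]; apply/hasP; exists s => //.
rewrite /hits ws sj prev_service_mem //=; apply/forallP => k.
apply/implyP => /andP[jk wk]; apply: le_trans sx (x_le _ _).
rewrite -(ltnS k) ltn_ord andbT leqNgt.
by apply: contraL jk => ki; rewrite -leqNgt; apply: prev_service_max.
Qed.

(* Unless the item is good, the reference schedule does not serve [w] between
   the previous service of [w] and the deadline of [q]. So it served [q] before
   that service, at which [q] was thus pending and made the fall of [w] stop. *)
Lemma good_or_down i w q : (0 < i <= m)%N -> q \in requests_at reqs e i ->
  anc par w (rnode q) -> ~~ served w (t i) (rdead q) ->
  good (prev i w) w || down (prev i w) w.
Proof.
move=> /andP[i_gt0 im] qp wq unserved_after; apply/norP => -[not_good].
have qr : q \in reqs by move: qp; rewrite mem_filter => /andP[].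
have unserved : ~~ served w (t (prev i w)) (rdead q).
  apply: contraNN not_good => /(served_split (t i)).
  rewrite (negbTE unserved_after) orbF; apply: served_good => k.
  exact: (run_time_le run_e).
have [s ss /and3P[qs qa qd]] := hasP (feas.2 q qr).
have arrived : rarr q <= t (prev i w).
  rewrite leNgt; apply: contraNN unserved => lt; apply/hasP; exists s => //.
  by rewrite qd (subtree_anc (feas.1 s ss) qs wq) (lt_le_trans lt).
have wS : w \in S (prev i w) by apply: prev_service_mem.
have [|d stopE dq] := run_stop run_e _ (t0_lt qr) qp arrived wS wq.
  by rewrite im andbT -(prednK i_gt0) ltnS prev_service_le.
rewrite /down wS not_good stopE negbK => /(served_widen dq).
by rewrite (negbTE unserved).
Qed.

Lemma down_closed a b : down a.1 a.2 -> flow a b != 0 ->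
  good b.1 b.2 || down b.1 b.2.
Proof.
move=> /and3P[_ _]; case stopE: (log_stop _ _) => [d|//] unserved.
move=> /flow_support[a_gt0 <- _ _ [q qp [ab bq]]].
rewrite stopE => qd; apply: good_or_down qp bq _.
  by rewrite a_gt0 -ltnS ltn_ord.
by apply: contraNN unserved => /(served_anc ab)/(served_widen qd).
Qed.

Lemma up_closed a b : up b.1 b.2 -> flow a b != 0 -> good a.1 a.2 || up a.1 a.2.
Proof.
move=> /and4P[_ bG bD _].
move=> /flow_support[a_gt0 prevE aS _ [q qp [ab bq q_reached]]].
have a_served : served a.2 (t a.1) (rdead q).
  apply: served_anc ab _; apply: contraT => unserved.
  have := good_or_down _ qp bq unserved.
  by rewrite prevE (negbTE bG) (negbTE bD) a_gt0 -ltnS ltn_ord => /(_ isT).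
have [//|aG] := boolP (good a.1 _); rewrite /up aS aG !andTb; apply/andP; split.
  rewrite /down aS aG /=; move: q_reached; rewrite /reached.
  by case: log_stop => // d qd; rewrite negbK (served_widen qd).
apply: contraNN aG => /eqP aE; rewrite aE in a_served *.
by apply: served_good a_served => k; lia.
Qed.

Lemma path_good_or_down i w : (0 < i <= m)%N -> w \in log_path (e i) ->
  good (prev i w) w || down (prev i w) w.
Proof.
case: i => // i /= im.
have [rho rho_pend [rho_t ->]] := step_trigger (run_step run_e im).
rewrite inE => w_rho; apply: good_or_down rho_pend w_rho _ => //.
by apply/hasPn => s _; rewrite rho_t; case: ltP; rewrite ?andbF.
Qed.

Lemma down_out a : down a.1 a.2 -> \sum_b flow a b = c a.2.
Proof.
rewrite flow_out; case: a => [[i im] v] /and3P[/= vS _].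
case stopE: (log_stop _ _) => [d|//] _.
have i_gt0 : (0 < i)%N.
  by case: i im vS stopE => // im _; rewrite (run_init run_e).
by apply: (fall_sum_stop (run_fall run_e _ vS)); rewrite ?stopE ?i_gt0.
Qed.

Lemma up_in b : up b.1 b.2 -> \sum_a flow a b = c b.2.
Proof.
move=> /and4P[bS bG bD b_ended]; rewrite flow_in; apply: received_ended => //.
  by rewrite ltn_neqAle b_ended prev_service_max.
move=> i im prevE; apply/negP => /(path_good_or_down (i := i.+1) im).
by rewrite prevE (negbTE bG) (negbTE bD).
Qed.

Definition good_items := [set a : item | good a.1 a.2].
Definition down_items := [set a : item | down a.1 a.2].
Definition up_items := [set a : item | up a.1 a.2].

Lemma good_items_cost_le :
  \sum_(a in good_items) c a.2 <= sched_cost c sched.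
Proof.
have c_ge0 v : 0 <= c v by apply: ltW.
pose hit s := [pred a : item | hits s a.1 a.2].
rewrite (eq_bigl (fun a => has (hit^~ a) sched)) => [|a]; last by rewrite inE.
apply: le_trans (ler_sum_has _ _ hit) _ => [a|]; first exact: ltW.
apply: ler_sum => s _; have hit_inj : {in hit s &, injective snd}.
  move=> [i v] [j w]; rewrite !inE /= => hi hj vw; rewrite -{}vw in hj *.
  move: hi hj => /and4P[vi _ ti /forallP li] /and4P[vj _ tj /forallP lj].
  congr (_, _); apply: val_inj; case: (ltngtP i j) => // lt.
    by have := li j; rewrite lt vj /= leNgt tj.
  by have := lj i; rewrite lt vi /= leNgt ti.
rewrite -(big_imset (A := hit s) c hit_inj); apply: ler_sum_subpred => // v.
by case/imsetP => a /and4P[_ + _ _] ->.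
Qed.

Lemma ended_items_cost_le :
  \sum_(a : item | (a.2 \in S a.1) && (a.1 != prev m.+1 a.2 :> nat)) c a.2
  <= \sum_(a in good_items :|: (down_items :|: up_items)) c a.2.
Proof.
apply: ler_sum_subpred => [a|a /andP[aS ended]]; first exact: ltW.
by rewrite !inE /up aS ended; case: good => //; case: down.
Qed.

Lemma run_cost_le :
  sched_cost c (transmissions e m) <= (depth par)%:R * sched_cost c sched.
Proof.
have -> : sched_cost c (transmissions e m)
    = \sum_(i < m) \sum_(w in S i.+1) c w.
  rewrite /sched_cost big_map -[m in iota _ m]subn0 -/(index_iota 0 m).
  by rewrite big_mkord.
rewrite -(sum_ended_items S0); apply: le_trans ended_items_cost_le _.
apply: le_trans (ler_wpM2l (ler0n _ _) good_items_cost_le).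
apply: (@flow_cost_le _ _ (fun a : item => c a.2) flow
  (fun a : item => level r par a.2)).
- exact: flow_ge0.
- by move=> a; apply: level_lt_depth.
- by move=> a b /flow_support[_ _ _ neq [q _ [ab _ _]]]; apply: level_lt ab neq.
- by move=> b; rewrite flow_in received_le.
- exact: flow_out_le.
- by move=> a; rewrite inE; apply: down_out.
- by move=> a b; rewrite !inE; apply: down_closed.
- by move=> b; rewrite inE; apply: up_in.
- by move=> a b; rewrite !inE; apply: up_closed.
Qed.

End Accounting.

Lemma sorted_sort_uniq_key (d : Order.disp_t) (T : eqType) (U : orderType d)
    (key : T -> U) (s : seq T) : uniq [seq key x | x <- s] ->
  sorted (fun x y => (key x < key y)%O)
    (sort (fun x y => (key x <= key y)%O) s).
Proof.
move=> key_uniq; set s' := sort _ _.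
suff : sorted <%O [seq key x | x <- s'] by rewrite sorted_map.
rewrite lt_sorted_uniq_le.
rewrite (perm_uniq (perm_map _ (permEl (perm_sort _ s)))) key_uniq sorted_map.
by apply: sort_sorted => x y; apply: le_total.
Qed.

Lemma seq_lt_bound (R : realDomainType) (T : eqType) (f : T -> R) (s : seq T) :
  exists u, forall x, x \in s -> u < f x.
Proof.
elim: s => [|y s [u uP]]; first by exists 0.
exists (Num.min u (f y - 1)) => x; rewrite inE gt_min.
by case/predU1P => [->|/uP->//]; rewrite gtrBl ltr01 orbT.
Qed.

Theorem mainTheorem6 (R : realFieldType) (V : finType) (r : V) (par : V -> V)
    (c : V -> R) (enq : {set V} -> seq V) (reqs : seq (request R V)) :
  is_rooted_tree r par ->
  (forall v, 0 < c v) ->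
  (forall q, q \in reqs -> rarr q <= rdead q) ->
  uniq [seq rdead q | q <- reqs] ->
  (forall X : {set V}, perm_eq (enq X) (enum X)) ->
  forall sched : seq (service R V),
    feasible r par reqs sched ->
    sched_cost c (waterfall par c enq reqs)
      <= (depth par)%:R * sched_cost c sched.
Proof.
move=> tree c_gt0 arr_le dead_uniq enqP sched [subtrees satisfying].
rewrite /waterfall; set sreqs := sort _ reqs.
have memE : sreqs =i reqs by move=> q; rewrite mem_sort.
have [t0 t0_lt] := seq_lt_bound (@rarr R V) sreqs.
have sreqs_sorted : sorted (fun q q' : request R V => rdead q < rdead q') sreqs.
  exact: sorted_sort_uniq_key.
have sreqs_arr q : q \in sreqs -> rarr q <= rdead q.
  by rewrite memE; apply: arr_le.
have [m [e [run_e <-]]] :=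
  waterfall_run par c_gt0 enqP t0_lt sreqs_arr sreqs_sorted.
apply: run_cost_le tree c_gt0 t0_lt run_e _.
by split=> // q; rewrite memE; apply: satisfying.
Qed.
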